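(* Let $\Omega=[0,1]^2$, $N\in\mathbb{N}^*$, $h=1/N$ and $f\in C^0(\Omega)$, and let $X_h$, $T$, $\Delta_h$, $\nabla_h$, $\pi_1$ be the finite difference objects on the uniform Cartesian grid of size $h$ defined in the context. Let $P_h:X_h\to X_h$, $P_h(u)=-T(\Delta_h u)-\pi_1 f$, be the discrete differential embedding of $P(u)=-\Delta u-f$, and let $\mathcal{L}_h:X_h\to\mathbb{R}$, $$\mathcal{L}_h(u)=\frac12\sum_{\mathbf{j}\in J}|(\nabla_h u)_{\mathbf{j}}|^2\,h^2-\sum_{\mathbf{j}\in J}(\pi_1 f)_{\mathbf{j}}\,u_{\mathbf{j}}\,h^2,$$ be the discrete variational embedding of $\mathcal{L}(u)=\int_\Omega\left(\frac12|\nabla u|^2-fu\right)dx$. Then these discrete variational and differential embeddings of the Poisson problem are coherent. Precisely, the two discrete problems (i) find $u\in X_h$ such that $P_h(u)=-T(\Delta_h u)-\pi_1 f=0$; (ii) find $u\in X_h$ such that $D\mathcal{L}_h(u)(v_h)=0$ for all $v_h\in X_h$ have the same solutions.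
   Context: Setting: the Poisson problem $-\Delta u=f$ in $\Omega=[0,1]^2$ with $u=0$ on $\partial\Omega$. Notation. For $\mathbf{j}=(i,j)\in\mathbb{Z}^2$ write $0\le\mathbf{j}\le N$ if $0\le i\le N$ and $0\le j\le N$, and $0<\mathbf{j}<N$ if $0<i<N$ and $0<j<N$. Set $J=\{\mathbf{j}\in\mathbb{N}^2:\ 0\le\mathbf{j}\le N\}$ (here $0\in\mathbb{N}$) and let $x_{\mathbf{j}}=(ih,jh)$. Let $\mathcal{S}=\{u:\mathbb{Z}^2\to\mathbb{R}\}$ and $\mathcal{V}=\{\mathbf{p}:\mathbb{Z}^2\to\mathbb{R}^2\}$, with $u_{\mathbf{j}}=u_{i,j}=u(\mathbf{j})$ and $\mathbf{p}_{\mathbf{j}}=\mathbf{p}(\mathbf{j})$. The discrete space is $$X_h=\{u\in\mathcal{S}:\ u_{\mathbf{j}}=0\text{ if }\mathbf{j}\notin J\text{ and if }x_{\mathbf{j}}\in\partial\Omega\},$$ i.e. $u_{\mathbf{j}}=0$ unless $0<\mathbf{j}<N$. The truncation $T:\mathcal{S}\to X_h$ is $(Tu)_{\mathbf{j}}=u_{\mathbf{j}}$ if $0<\mathbf{j}<N$ and $(Tu)_{\mathbf{j}}=0$ otherwise. The projection $\pi_1:C^0(\Omega)\to X_h$ is $(\pi_1 u)_{\mathbf{j}}=u(x_{\mathbf{j}})$ if $0<\mathbf{j}<N$ and $(\pi_1 u)_{\mathbf{j}}=0$ otherwise. The discrete Laplacian $\Delta_h:\mathcal{S}\to\mathcal{S}$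 is $$(\Delta_h u)_{i,j}=\frac{u_{i-1,j}-2u_{i,j}+u_{i+1,j}}{h^2}+\frac{u_{i,j-1}-2u_{i,j}+u_{i,j+1}}{h^2}.$$ The discrete gradient $\nabla_h:\mathcal{S}\to\mathcal{V}$ is $$(\nabla_h u)_{i,j}=\frac1h\left(u_{i+1,j}-u_{i,j},\ u_{i,j+1}-u_{i,j}\right).$$ The differential is $D\mathcal{L}_h(u)(v)=\lim_{\epsilon\to0}\frac{\mathcal{L}_h(u+\epsilon v)-\mathcal{L}_h(u)}{\epsilon}$. Coherence: a discrete differential embedding $P_h$ (a discretisation of the Euler-Lagrange operator $P$) and a discrete variational embedding $\mathcal{L}_h$ (a discretisation of the Lagrangian functional $\mathcal{L}$) are called coherent if the discrete differential formulation $P_h(u)=0$ and the discrete variational formulation (discrete least action principle) $D\mathcal{L}_h(u)(v_h)=0$ for all discrete variations $v_h$ are equivalent, i.e. have the same solutions. *)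

(* Defs.v *)
From mathcomp Require Import all_boot all_order all_algebra.
From mathcomp Require Import all_classical all_reals all_analysis.

Set Implicit Arguments.
Unset Strict Implicit.
Unset Printing Implicit Defensive.

Import Order.TTheory GRing.Theory Num.Theory.
Import numFieldNormedType.Exports.

Local Open Scope classical_set_scope.
Local Open Scope ring_scope.

Notation "''S[' R ]" := (int * int -> R) (only parsing) : type_scope.
Notation "''V[' R ]" := (int * int -> R * R) (only parsing) : type_scope.

Definition Omega (R : realType) : set (R * R) := `[0, 1] `*` `[0, 1].

Definition mesh (R : realType) (N : nat) : R := N%:R^-1.

Definition node (R : realType) (N : nat) (j : int * int) : R * R :=
  (j.1%:~R * mesh R N, j.2%:~R * mesh R N).

Definition inner (N : nat) (j : int * int) : bool :=
  [&& 0 < j.1, j.1 < N%:Z, 0 < j.2 & j.2 < N%:Z].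

(* Since N * mesh = 1, [~~ inner N j] says that j lies outside {0, ..., N}^2 or
   that its node lies on the boundary of Omega. *)
Definition Xh (R : realType) (N : nat) : set 'S[R] :=
  [set u | forall j, ~~ inner N j -> u j = 0].

Definition trunc (R : realType) (N : nat) (u : 'S[R]) : 'S[R] :=
  fun j => if inner N j then u j else 0.

Definition pi1 (R : realType) (N : nat) (f : R * R -> R) : 'S[R] :=
  fun j => if inner N j then f (node R N j) else 0.

Definition laplacian_h (R : realType) (h : R) (u : 'S[R]) : 'S[R] :=
  fun '(i, j) =>
    (u (i - 1, j) - 2 * u (i, j) + u (i + 1, j)) / h ^+ 2
    + (u (i, j - 1) - 2 * u (i, j) + u (i, j + 1)) / h ^+ 2.

Definition gradient_h (R : realType) (h : R) (u : 'S[R]) : 'V[R] :=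
  fun '(i, j) =>
    (h^-1 * (u (i + 1, j) - u (i, j)), h^-1 * (u (i, j + 1) - u (i, j))).

(* Squared Euclidean norm; the library's norm on R * R is the sup norm. *)
Definition sqnorm (R : realType) (p : R * R) : R := p.1 ^+ 2 + p.2 ^+ 2.

(* Sum over the grid J = {0, ..., N}^2, seen inside Z^2. *)
Definition grid_sum (R : realType) (N : nat) (F : int * int -> R) : R :=
  \sum_(i < N.+1) \sum_(j < N.+1) F (i%:Z, j%:Z).

Definition Ph (R : realType) (N : nat) (f : R * R -> R) (u : 'S[R]) : 'S[R] :=
  - trunc N (laplacian_h (mesh R N) u) - pi1 N f.

Definition Lh (R : realType) (N : nat) (f : R * R -> R) (u : 'S[R]) : R :=
  2^-1 * grid_sum N (fun j => sqnorm (gradient_h (mesh R N) u j) * mesh R N ^+ 2)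
  - grid_sum N (fun j => pi1 N f j * u j * mesh R N ^+ 2).

Lemma trunc_Xh (R : realType) (N : nat) (u : 'S[R]) : Xh N (trunc N u).
Proof. by move=> j /negbTE jN; rewrite /trunc jN. Qed.

Lemma pi1_Xh (R : realType) (N : nat) (f : R * R -> R) : Xh N (pi1 N f).
Proof. by move=> j /negbTE jN; rewrite /pi1 jN. Qed.

Lemma Ph_Xh (R : realType) (N : nat) (f : R * R -> R) (u : 'S[R]) :
  Xh N (Ph N f u).
Proof.
move=> j jN.
have -> : Ph N f u j = - trunc N (laplacian_h (mesh R N) u) j - pi1 N f j by [].
by rewrite trunc_Xh// pi1_Xh// oppr0 addr0.
Qed.

(* DL(u)(v) = d, the existence of the limit being part of the assertion. *)
Definition differential_is (R : realType) (L : 'S[R] -> R) (u v : 'S[R])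
    (d : R) : Prop :=
  (L (u + e *: v) - L u) / e @[e --> (0 : R)^'] --> d.

(* The differential formulation P u = 0 and the variational formulation
   DL(u) = 0, both posed in X, have the same solutions. *)
Definition coherent (R : realType) (X : set 'S[R]) (P : 'S[R] -> 'S[R])
    (L : 'S[R] -> R) : Prop :=
  [set u | X u /\ P u = 0] =
  [set u | X u /\ forall v, X v -> differential_is L u v 0].

(* Main.v *)
Require Import Defs.
From mathcomp Require Import all_boot all_order all_algebra.
From mathcomp Require Import all_classical all_reals all_analysis.
From mathcomp Require Import ring zify.

Set Implicit Arguments.
Unset Strict Implicit.
Unset Printing Implicit Defensive.

Import Order.TTheory GRing.Theory Num.Theory.
Import numFieldNormedType.Exports.
Local Open Scope classical_set_scope.
Local Open Scope ring_scope.

(** Along a line u + e v the discrete Lagrangian is the quadratic polynomial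
    L(u) + e B(u, v) + e^2 Q(v), so DL(u)(v) = B(u, v).  Summation by parts, whose
    boundary terms vanish because v is zero outside the interior nodes, turns
    B(u, v) into the grid inner product h^2 (P_h(u), v).  Testing with
    v = P_h(u), which lies in X_h, shows that B(u, .) = 0 forces P_h(u) = 0. *)

Lemma grid_sumD (R : realType) (N : nat) (F G : int * int -> R) :
  grid_sum N (fun j => F j + G j) = grid_sum N F + grid_sum N G.
Proof.
by rewrite /grid_sum -big_split; apply: eq_bigr => i _; rewrite -big_split.
Qed.

Lemma grid_sumZ (R : realType) (N : nat) (a : R) (F : int * int -> R) :
  grid_sum N (fun j => a * F j) = a * grid_sum N F.
Proof.
by rewrite /grid_sum mulr_sumr; apply: eq_bigr => i _; rewrite mulr_sumr.
Qed.

Lemma grid_sumN (R : realType) (N : nat) (F : int * int -> R) :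
  grid_sum N (fun j => - F j) = - grid_sum N F.
Proof. by rewrite /grid_sum -sumrN; apply: eq_bigr => i _; rewrite sumrN. Qed.

Lemma eq_grid_sum (R : realType) (N : nat) (F G : int * int -> R) :
  F =1 G -> grid_sum N F = grid_sum N G.
Proof. by move=> FG; apply: eq_bigr => i _; apply: eq_bigr => j _. Qed.

(** This gives definiteness of the grid inner product on interior nodes. *)
Lemma grid_sum_eq0 (R : realType) (N : nat) (F : int * int -> R) :
  (forall j, 0 <= F j) -> grid_sum N F = 0 -> forall j, inner N j -> F j = 0.
Proof.
move=> F_ge0 /eqP; rewrite psumr_eq0; last by move=> i _; apply: sumr_ge0.
move=> /allP F0 [i j] /and4P[/= i_gt0 ltiN j_gt0 ltjN].
(* The sum runs over ordinals, so the positive integers [i] and [j] are turned into indices through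
   their absolute values. *)
have /= lt_i : (`|i|%N < N.+1)%N by lia.
have /= lt_j : (`|j|%N < N.+1)%N by lia.
have := F0 (Ordinal lt_i) (mem_index_enum _).
rewrite psumr_eq0// => /allP /(_ (Ordinal lt_j) (mem_index_enum _)) /= /eqP.
by rewrite !gtz0_abs.
Qed.

(** The two summands add up to [g k.+1 - g k] with [g k] the backward difference of [a] at [k] times
    [b k]; the sum telescopes and [b] kills both ends. *)
Lemma sum_by_parts (R : realType) (n : nat) (a b : int -> R) :
  b 0 = 0 -> b n%:Z = 0 ->
  \sum_(i < n) (a (i%:Z + 1) - a i%:Z) * (b (i%:Z + 1) - b i%:Z) =
  - \sum_(i < n) (a (i%:Z - 1) - 2 * a i%:Z + a (i%:Z + 1)) * b i%:Z.
Proof.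
move=> b0 bn; apply/eqP; rewrite -subr_eq0 opprK -big_split /=; apply/eqP.
pose g (k : nat) := (a k%:Z - a (k%:Z - 1)) * b k%:Z.
rewrite -(big_mkord xpredT (fun k : nat =>
  (a (k%:Z + 1) - a k%:Z) * (b (k%:Z + 1) - b k%:Z) +
  (a (k%:Z - 1) - 2 * a k%:Z + a (k%:Z + 1)) * b k%:Z)).
rewrite (eq_bigr (fun k => g k.+1 - g k)); last first.
  move=> k _; rewrite /g.
  have -> : k.+1%:Z = k%:Z + 1 by lia.
  by rewrite addrK; ring.
by rewrite telescope_sumr// /g b0 bn !mulr0 subr0.
Qed.

(** The polar form of [sqnorm]: it is the cross term when the energy is expanded along a line. *)
Definition dotV (R : realType) (p q : R * R) : R := p.1 * q.1 + p.2 * q.2.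

Lemma grid_sum_gradient (R : realType) (N : nat) (u v : 'S[R]) (h : R) :
  Xh N v ->
  grid_sum N (fun j => dotV (gradient_h h u j) (gradient_h h v j)) =
  - grid_sum N (fun j => laplacian_h h u j * v j).
Proof.
move=> Xv.
have v0 i j : ~~ inner N (i, j) -> v (i, j) = 0 by exact: Xv.
pose dx j := (u (j.1 + 1, j.2) - u j) * (v (j.1 + 1, j.2) - v j).
pose dy j := (u (j.1, j.2 + 1) - u j) * (v (j.1, j.2 + 1) - v j).
pose ddx j := (u (j.1 - 1, j.2) - 2 * u j + u (j.1 + 1, j.2)) * v j.
pose ddy j := (u (j.1, j.2 - 1) - 2 * u j + u (j.1, j.2 + 1)) * v j.
rewrite (@eq_grid_sum _ _ _ (fun j => h^-1 ^+ 2 * (dx j + dy j))); last first.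
  by case=> i j; rewrite /dotV /dx /dy /=; ring.
rewrite (@eq_grid_sum _ _ (fun j => laplacian_h h u j * v j)
  (fun j => h^-1 ^+ 2 * (ddx j + ddy j))); last first.
  by case=> i j; rewrite /ddx /ddy /= -exprVn; ring.
rewrite !grid_sumZ !grid_sumD -mulrN opprD; congr (_ * (_ + _)).
  (* For the first direction the sums are exchanged, so that the inner one runs over [i] at fixed
     [j]. *)
  rewrite /grid_sum exchange_big [in RHS]exchange_big /= -sumrN.
  (* The indices 0 to N form a range of length N + 1, so the end values are those of [v] at 0 and N
     + 1, both outside the interior. *)
  apply: eq_bigr => j _; rewrite (@sum_by_parts _ N.+1
    (fun i => u (i, j%:Z)) (fun i => v (i, j%:Z)))//; apply: v0;
  by rewrite /inner /=; lia.
rewrite /grid_sum -sumrN; apply: eq_bigr => i _.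
rewrite (@sum_by_parts _ N.+1
  (fun j => u (i%:Z, j)) (fun j => v (i%:Z, j)))//; apply: v0;
by rewrite /inner /=; lia.
Qed.

Lemma Lh_line (R : realType) (N : nat) (f : R * R -> R) (u v : 'S[R]) (e : R) :
  Xh N v ->
  Lh N f (u + e *: v) = Lh N f u
    + e * (mesh R N ^+ 2 * grid_sum N (fun j => Ph N f u j * v j))
    + e ^+ 2 * (2^-1 * grid_sum N (fun j =>
        sqnorm (gradient_h (mesh R N) v j) * mesh R N ^+ 2)).
Proof.
move=> Xv; set h := mesh R N.
have -> : grid_sum N (fun j => Ph N f u j * v j) =
    grid_sum N (fun j => dotV (gradient_h h u j) (gradient_h h v j))
    - grid_sum N (fun j => pi1 N f j * v j).
  rewrite grid_sum_gradient// -!grid_sumN -grid_sumD.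
  apply: eq_grid_sum => j.
  have -> : Ph N f u j = - trunc N (laplacian_h h u) j - pi1 N f j by [].
  (* Truncation is invisible when paired with [v]: where it changes the Laplacian, [v] vanishes. *)
  rewrite /trunc; case: ifPn => [_|/Xv ->]; ring.
have grad2 : grid_sum N (fun j => sqnorm (gradient_h h (u + e *: v) j) * h ^+ 2) =
    grid_sum N (fun j => sqnorm (gradient_h h u j) * h ^+ 2)
    + 2 * e * h ^+ 2 *
      grid_sum N (fun j => dotV (gradient_h h u j) (gradient_h h v j))
    + e ^+ 2 * grid_sum N (fun j => sqnorm (gradient_h h v j) * h ^+ 2).
  rewrite -!grid_sumZ -!grid_sumD; apply: eq_grid_sum => -[i j].
  have E k : (u + e *: v) k = u k + e * v k by [].
  by rewrite /sqnorm /dotV /= !E; ring.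
have load : grid_sum N (fun j => pi1 N f j * (u + e *: v) j * h ^+ 2) =
    grid_sum N (fun j => pi1 N f j * u j * h ^+ 2)
    + e * h ^+ 2 * grid_sum N (fun j => pi1 N f j * v j).
  rewrite -!grid_sumZ -!grid_sumD; apply: eq_grid_sum => j.
  have -> : (u + e *: v) j = u j + e * v j by [].
  by ring.
by rewrite /Lh -/h grad2 load; field.
Qed.

Lemma differential_Lh (R : realType) (N : nat) (f : R * R -> R) (u v : 'S[R]) :
  Xh N v ->
  differential_is (Lh N f) u v
    (mesh R N ^+ 2 * grid_sum N (fun j => Ph N f u j * v j)).
Proof.
move=> Xv; rewrite /differential_is.
set B := _ * grid_sum _ _.
set Q := 2^-1 * grid_sum N (fun j =>
  sqnorm (gradient_h (mesh R N) v j) * mesh R N ^+ 2).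
(* By [Lh_line] the difference quotient equals [B + e * Q] for every nonzero [e]. *)
have lim : B + e * Q @[e --> (0 : R)^'] --> B.
  rewrite -[X in _ --> X]addr0 -[X in _ --> _ + X](mul0r Q).
  apply: cvgD; first exact: cvg_cst.
  apply: cvgMr_tmp; exact: nbhs_dnbhs.
apply: cvg_trans lim; apply: near_eq_cvg.
near=> e.
have e_neq0 : e != 0 by near: e; exact: nbhs_dnbhs_neq.
by rewrite Lh_line// -/B -/Q; field.
Unshelve. all: by end_near. Qed.

Theorem theorem2 (R : realType) (N : nat) (N_gt0 : (0 < N)%N)
    (f : R * R -> R) (f_cont : {within @Omega R, continuous f}) :
  coherent (@Xh R N) (@Ph R N f) (@Lh R N f).
Proof.
apply/seteqP; split=> u /= [Xu].
  move=> P0; split=> // v Xv; have := @differential_Lh R N f u v Xv.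
  (* The zero summand is written as a product so that [grid_sumZ] can pull out a factor 0. *)
  rewrite P0 (@eq_grid_sum _ _ _ (fun=> 0 * 0)) => [|j]; last first.
    by rewrite mulr0; exact: mul0r.
  by rewrite grid_sumZ mul0r mulr0.
move=> crit; split=> //; apply/funext => j; change (Ph N f u j = 0).
have XP := @Ph_Xh R N f u.
have [jN|/XP//] := boolP (inner N j).
(* With the variation [Ph N f u], the limit is both 0 and the squared grid norm of [Ph N f u]. *)
have := cvg_unique (@Rhausdorff R) (@differential_Lh R N f u _ XP) (crit _ XP).
(* [N_gt0] enters here: at N = 0 the inverse of zero is zero by convention. *)
have h_neq0 : mesh R N ^+ 2 != 0.
  by rewrite expf_neq0// invr_eq0 pnatr_eq0 -lt0n.
move=> /(_ _)/eqP; rewrite mulf_eq0 (negbTE h_neq0) /= => /eqP sum0.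
have := @grid_sum_eq0 _ N (fun j => Ph N f u j * Ph N f u j)
  (fun j => sqr_ge0 _) sum0 j jN.
by move/eqP; rewrite mulf_eq0 orbb => /eqP.
Qed.
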